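(* For all $\lambda_1,\lambda_2\in[0,1]$ and irrational $\Phi\in\mathbb T$, $$\mathbf W_{\lambda_1,\lambda_2,\Phi}\,\mathcal A_\Phi\,\mathcal X=\mathcal A_\Phi\,\mathcal X\,\mathbf W^\top_{\lambda_2,\lambda_1,\Phi},$$ where $\mathbf W_{\lambda_1,\lambda_2,\Phi}=\int_{\mathbb T}^\oplus W_{\lambda_1,\lambda_2,\Phi,\theta}\,d\theta$ and $\mathbf W^\top_{\lambda_2,\lambda_1,\Phi}=\int_{\mathbb T}^\oplus W^\top_{\lambda_2,\lambda_1,\Phi,\theta}\,d\theta$.
   Context: Let $\mathbb T=\mathbb R/\mathbb Z$. Let $\mathscr H_1=\ell^2(\mathbb Z)\otimes\mathbb C^2$ with orthonormal basis $\delta_n^{s}=\delta_n\otimes e_s$ ($n\in\mathbb Z$, $s\in\{+,-\}$), $e_+=(1,0)^\top$, $e_-=(0,1)^\top$; write $\psi_n^s=\langle\delta_n^s,\psi\rangle$ and $\psi_n=(\psi_n^+,\psi_n^-)^\top$. For $\lambda\in[0,1]$ put $\lambda'=\sqrt{1-\lambda^2}$ and let $S_\lambda$ be the unitary operator with $S_\lambda\delta_n^\pm=\lambda\delta_{n\pm1}^\pm\pm\lambda'\delta_n^\mp$. For $\lambda_2\in[0,1]$, $\Phi,\theta\in\mathbb T$, $n\in\mathbb Z$ let $$Q_n=Q_{\lambda_2,\Phi,\theta,n}=\begin{bmatrix}\lambda_2\cos(2\pi(n\Phi+\theta))+i\lambda_2' & -\lambda_2\sin(2\pi(n\Phi+\theta))\\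 \lambda_2\sin(2\pi(n\Phi+\theta)) & \lambda_2\cos(2\pi(n\Phi+\theta))-i\lambda_2'\end{bmatrix},$$ and let $Q_{\lambda_2,\Phi,\theta}$ act by $(Q\psi)_n=Q_n\psi_n$. The unitary almost-Mathieu operator is $W_{\lambda_1,\lambda_2,\Phi,\theta}=S_{\lambda_1}Q_{\lambda_2,\Phi,\theta}$ on $\mathscr H_1$, for $\lambda_1,\lambda_2\in[0,1]$. Transposes are taken with respect to the basis $\{\delta_n^s\}$. Let $\mathscr H_\oplus=\int_{\mathbb T}^\oplus\mathscr H_1\,d\theta$, with elements $\Psi$ having coordinates $\Psi_n^s(\theta)$ ($n\in\mathbb Z$, $s\in\{\pm\}$, $\theta\in\mathbb T$). The Fourier transform is $\widehat\Psi_n^s(\theta)=\sum_{m\in\mathbb Z}\int_{\mathbb T}e^{-2\pi im\theta}e^{-2\pi inx}\Psi_m^s(x)\,dx$, and the Aubry dual operator $\mathcal A_\Phi:\mathscr H_\oplus\to\mathscr H_\oplus$ is $[\mathcal A_\Phi\Psi]_n^s(\theta)=\widehat\Psi_n^s(n\Phi+\theta)$. Finally $\mathcal X=\int_{\mathbb T}^\oplus\bigoplus_{n\in\mathbb Z}\frac{1}{\sqrt2}\begin{bmatrix}i&1\\1&i\end{bmatrix}dx$, i.e. $\mathcal X$ acts on each fiber by applying the matrix $\frac1{\sqrt2}\begin{bmatrix}i&1\\1&i\end{bmatrix}$ to every $\Psi_n(\theta)=(\Psi_n^+(\theta),\Psi_n^-(\theta))^\top$. *)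

(* Defs.v *)
From HB Require Import structures.
From mathcomp Require Import all_boot all_order all_algebra.
From mathcomp Require Import all_classical all_reals all_analysis.
From mathcomp.real_closed Require Import complex.
Import Order.TTheory GRing.Theory Num.Theory.

Set Implicit Arguments.
Unset Strict Implicit.
Unset Printing Implicit Defensive.

Local Open Scope classical_set_scope.
Local Open Scope ring_scope.

Section UAMO.
Variable R : realType.

Definition rC (x : R) : R[i] := (x%:C)%C.
Definition iC : R[i] := (0 +i* 1)%C.
Definition expi (t : R) : R[i] := (cos t +i* sin t)%C.
Definition sqn (z : R[i]) : R := complex.Re z ^+ 2 + complex.Im z ^+ 2.
Definition cint (f : R -> R[i]) : R[i] :=
  (Rintegral lebesgue_measure `[0%R, 1%R] (fun x => complex.Re (f x)) +i*
   Rintegral lebesgue_measure `[0%R, 1%R] (fun x => complex.Im (f x)))%C.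

(* ---------- the fiber space  H_1 = l^2(Z) (x) C^2 ----------
   A vector psi is given by its coordinates psi n s = <delta_n^s, psi>,
   with s = true for "+" and s = false for "-". *)
Definition state := int -> bool -> R[i].

Definition delta (m : int) (t : bool) : state :=
  fun n s => if (n == m) && (s == t) then 1 else 0.

Definition lamp (l : R) : R := Num.sqrt (1 - l ^+ 2).

Definition Sdelta (l : R) (m : int) (t : bool) : state :=
  if t then (fun n s => rC l * delta (m + 1) true n s + rC (lamp l) * delta m false n s)
       else (fun n s => rC l * delta (m - 1) false n s - rC (lamp l) * delta m true n s).

(* S_lambda psi = sum_{m,t} psi_m^t S delta_m^t ; the coordinate (n,s) only
   receives contributions from m in {n-1, n, n+1}. *)
Definition Sapp (l : R) (psi : state) : state :=
  fun n s => \sum_(k < 3) \sum_(t : bool)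
               psi (n + k%:Z - 1) t * Sdelta l (n + k%:Z - 1) t n s.

Definition Qent (l2 Phi theta : R) (n : int) (s t : bool) : R[i] :=
  let a := 2 * pi * (n%:~R * Phi + theta) in
  match s, t with
  | true, true => (l2 * cos a +i* lamp l2)%C
  | true, false => rC (- (l2 * sin a))
  | false, true => rC (l2 * sin a)
  | false, false => (l2 * cos a +i* - lamp l2)%C
  end.

Definition Qapp (l2 Phi theta : R) (psi : state) : state :=
  fun n s => \sum_(t : bool) Qent l2 Phi theta n s t * psi n t.

Definition Wop (l1 l2 Phi theta : R) (psi : state) : state :=
  Sapp l1 (Qapp l2 Phi theta psi).

(* transpose w.r.t. the basis {delta_n^s} of an operator A whose matrix is
   supported in |n - m| <= 1 (true for W, whose matrix is tridiagonal in n):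
   (A^T psi)_m^t = sum_{n,s} <delta_n^s, A delta_m^t> psi_n^s. *)
Definition transp3 (A : state -> state) (psi : state) : state :=
  fun m t => \sum_(k < 3) \sum_(s : bool)
               A (delta m t) (m + k%:Z - 1) s * psi (m + k%:Z - 1) s.

Definition WTop (l1 l2 Phi theta : R) : state -> state :=
  transp3 (Wop l1 l2 Phi theta).

(* ---------- the direct integral H_plus = int^+_T H_1 dtheta ----------
   An element is Psi n s theta, with theta in T represented by 1-periodic
   functions of theta : R. *)
Definition field := int -> bool -> R -> R[i].

Definition InH (Psi : field) : Prop :=
  (forall n s x, Psi n s (x + 1) = Psi n s x) /\
  (forall n s, measurable_fun setT (fun x => complex.Re (Psi n s x)) /\
               measurable_fun setT (fun x => complex.Im (Psi n s x))) /\
  (\esum_(p in [set: int * bool])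
      \int[lebesgue_measure]_(x in `[0%R, 1%R]) (sqn (Psi p.1 p.2 x))%:E < +oo)%E.

Definition fiber (Psi : field) (theta : R) : state := fun n s => Psi n s theta.

Definition dint (A : R -> state -> state) (Psi : field) : field :=
  fun n s theta => A theta (fiber Psi theta) n s.

Definition Xent (s t : bool) : R[i] :=
  rC (Num.sqrt 2)^-1 * (if s == t then iC else 1).
Definition Xop (Psi : field) : field :=
  fun n s theta => \sum_(t : bool) Xent s t * Psi n t theta.

(* Fourier transform: G = Psi^hat, where
   Psi^hat_n^s(theta) = sum_{m in Z} e^{-2 pi i m theta}
                         \int_T e^{-2 pi i n x} Psi_m^s(x) dx,
   the series in m converging in L^2(T, dtheta) (symmetric partial sums). *)
Definition fcoef (Psi : field) (m n : int) (s : bool) : R[i] :=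
  cint (fun x => expi (- (2 * pi * n%:~R * x)) * Psi m s x).

Definition hat_partial (Psi : field) (M : nat) (n : int) (s : bool) (theta : R)
  : R[i] :=
  \sum_(j < (M + M).+1)
     expi (- (2 * pi * (j%:Z - M%:Z)%:~R * theta)) * fcoef Psi (j%:Z - M%:Z) n s.

Definition IsHat (Psi G : field) : Prop :=
  InH G /\
  forall n s,
    ((fun M : nat => (\int[lebesgue_measure]_(theta in `[0%R, 1%R])
         (sqn (G n s theta - hat_partial Psi M n s theta))%:E)%E) @ \oo --> 0%E).

Definition Ashift (Phi : R) (G : field) : field :=
  fun n s theta => G n s (n%:~R * Phi + theta).

End UAMO.

(* Main.v *)
(* A function is represented by a two-sided sequence [c] when it is the L^2
   limit of the symmetric partial sums [sum_(|j| <= M) c_j e^(-2 pi i j x)].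
   Shifting [c] by [1] multiplies the function by [e^(2 pi i x)], and twisting
   [c_m] by [e^(2 pi i m Phi)] translates it by [Phi]; dually, multiplying a
   function by a character shifts the index of its Fourier coefficient.
   Conjugation by [X] turns [S_l2^T] into the shift form of [Q_l2], and [Q_l1^T]
   into the multiplication form of [S_l1], so both sides of the identity have
   the same coefficients and hence agree almost everywhere.  The L^2 limits are
   given by the hypotheses, so Plancherel's theorem is never needed. *)
Require Import Defs.
From HB Require Import structures.
From mathcomp Require Import all_boot all_order all_algebra.
From mathcomp Require Import all_classical all_reals all_analysis.
From mathcomp.real_closed Require Import complex.
From mathcomp Require Import measurable_realfun.
From mathcomp Require Import zify ring lra.
Import Order.TTheory GRing.Theory Num.Theory.
Import numFieldNormedType.Exports.
Set Implicit Arguments.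
Unset Strict Implicit.
Unset Printing Implicit Defensive.
Local Open Scope classical_set_scope.
Local Open Scope ring_scope.

(** * Translation invariance of Lebesgue measure and integrals of periodic functions *)

Lemma lebesgue_measure_translation {R : realType} (t : R) (A : set R) :
  measurable A ->
  lebesgue_measure ((fun x => x + t) @^-1` A) = lebesgue_measure A.
Proof.
have mt : @measurable_fun _ _ (measurableTypeR R) (measurableTypeR R) setT
    (fun x => x + t).
  exact: measurable_funD.
pose f : {mfun measurableTypeR R >-> measurableTypeR R} :=
  @mfun_Sub _ _ (measurableTypeR R) (measurableTypeR R) _ (mem_set mt).
move=> mA.
(* The image of Lebesgue measure under the translation gives half-open intervals their length, which
   determines Lebesgue measure. *)
rewrite [RHS](@lebesgue_measure_unique R (pushforward lebesgue_measure f)) //.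
move=> X [[a b] _ <-] /=.
rewrite /pushforward.
have -> : f @^-1` `]a, b]%classic = `]a - t, b - t]%classic.
  by apply/seteqP; split => x /=; rewrite !in_itv /= ltrBlDr lerBrDr.
rewrite !lebesgue_measure_itv /= !lte_fin ltrD2r.
case: ifP => // _; rewrite -!EFinB; congr EFin; ring.
Qed.

Lemma ge0_integral_translation {R : realType} (t : R) (D : set R)
    (f : R -> \bar R) : measurable D -> measurable_fun setT f ->
  (forall x, 0 <= f x)%E ->
  (\int[lebesgue_measure]_(x in (fun x => (x + t)%R) @^-1` D) f (x + t)%R =
   \int[lebesgue_measure]_(x in D) f x)%E.
Proof.
move=> mD mf f0.
have mt : @measurable_fun _ _ (measurableTypeR R) (measurableTypeR R) setT
    (fun x => x + t).
  exact: measurable_funD.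
pose g : {mfun measurableTypeR R >-> measurableTypeR R} :=
  @mfun_Sub _ _ (measurableTypeR R) (measurableTypeR R) _ (mem_set mt).
rewrite -(ge0_integral_pushforward (phi := g)) //.
  by apply: eq_measure_integral => A mA _; exact: lebesgue_measure_translation.
exact: measurable_funTS.
Qed.

Lemma periodic_intr {R : realType} {T : Type} (f : R -> T) :
  (forall x, f (x + 1) = f x) -> forall (k : int) x, f (x + k%:~R) = f x.
Proof.
move=> per; have pern n : forall x, f (x + n%:R) = f x.
  by elim: n => [|n IH] x; rewrite ?addr0// -natr1 addrA per IH.
case=> n x; first exact: pern.
by rewrite NegzE mulrNz -(pern n.+1 (x - _)) subrK.
Qed.

Lemma measurable_preimage_translation {R : realType} (t : R) (D : set R) :
  measurable D -> measurable ((fun x : R => x + t) @^-1` D).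
Proof.
by move=> mD; rewrite -[X in measurable X]setTI; exact: measurable_funD.
Qed.

(** An integer translation changes nothing, so [t] is replaced by its fractional part [r]. The
    translated period then covers [[r, 1[] and, after wrapping around, [[0, r[]. *)
Lemma ge0_integral_periodic {R : realType} (t : R) (f : R -> \bar R) :
  measurable_fun setT f -> (forall x, 0 <= f x)%E ->
  (forall x, f (x + 1)%R = f x) ->
  (\int[lebesgue_measure]_(x in `[0%R, 1%R]) f (x + t)%R =
   \int[lebesgue_measure]_(x in `[0%R, 1%R]) f x)%E.
Proof.
move=> mf f0 per.
set r := t - (Num.floor t)%:~R.
have /andP[r0 r1] : 0 <= r < 1.
  have := floor_itv t; rewrite /r intrD1 => /andP[h1 h2].
  by rewrite subr_ge0 h1 ltrBlDr addrC.
have mfr s : measurable_fun setT (fun x : R => f (x + s)).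
  by apply: (measurableT_comp mf); exact: measurable_funD.
transitivity (\int[lebesgue_measure]_(x in `[0%R, 1%R[) f (x + r)%R)%E.
  rewrite integral_itv_bndo_bndc; last exact: measurable_funTS.
  apply: eq_integral => x _.
  by rewrite -[in LHS](subrK (Num.floor t)%:~R t) addrA periodic_intr.
transitivity (\int[lebesgue_measure]_(x in `[r, 1%R[) f x +
              \int[lebesgue_measure]_(x in `[0%R, r[) f x)%E.
  rewrite -(ge0_integral_translation r (D := `[r, 1%R[)) //.
  (* The wrapped piece is translated by [r - 1]; periodicity restores the common integrand
     [f (x + r)]. *)
  rewrite -(ge0_integral_translation (r - 1)%R (D := `[0%R, r[)) //.
  rewrite [X in (_ = _ + X)%E](_ : _ =
      \int[lebesgue_measure]_(x in (fun x => (x + (r - 1))%R) @^-1` `[0%R, r[)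
        f (x + r)%R)%E; last first.
    by apply: eq_integral => x _; rewrite -[LHS]per; congr f; ring.
  rewrite -ge0_integral_setU //.
  - congr integral; apply/seteqP; split => x /=; rewrite !in_itv /=.
      move=> /andP[x0 x1]; have [h|h] := ltP (x + r) 1.
        by left; apply/andP; split; lra.
      by right; apply/andP; split; lra.
    by case => /andP[h1 h2]; apply/andP; split; lra.
  - exact: measurable_preimage_translation.
  - exact: measurable_preimage_translation.
  - by apply: measurable_funTS; exact: mfr.
  - apply/disj_setPS => x /= []; rewrite !in_itv /=.
    move=> /andP[h1 h2] /andP[h3 h4].
    exfalso; lra.
rewrite addeC -ge0_integral_setU //.
- rewrite -integral_itv_bndo_bndc; last exact: measurable_funTS.
  congr integral; apply/seteqP; split => x /=; rewrite !in_itv /=.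
    by case => /andP[h1 h2]; apply/andP; split; lra.
  move=> /andP[x0 x1]; have [h|h] := ltP x r; first by left; rewrite x0.
  by right; rewrite x1.
- exact: measurable_funTS.
- apply/disj_setPS => x /= []; rewrite !in_itv /=.
  move=> /andP[h1 h2] /andP[h3 h4].
  exfalso; lra.
Qed.

(** * The squared modulus and the complex exponential *)

Section SquareModulus.
Variable R : realType.
Implicit Types z w : R[i].

Lemma complex_ext z w :
  complex.Re z = complex.Re w -> complex.Im z = complex.Im w -> z = w.
Proof. by case: z => a b; case: w => c d /= -> ->. Qed.

Lemma sqn_ge0 z : 0 <= sqn z.
Proof. by rewrite addr_ge0 ?sqr_ge0. Qed.

Lemma sqn1 : sqn (1 : R[i]) = 1.
Proof. by rewrite /sqn /= expr1n expr0n addr0. Qed.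

Lemma sqnM z w : sqn (z * w) = sqn z * sqn w.
Proof. case: z => a b; case: w => c d; rewrite /sqn /=; ring. Qed.

Lemma sqnN z : sqn (- z) = sqn z.
Proof. case: z => a b; rewrite /sqn /=; ring. Qed.

Lemma sqn_parallelogram z w :
  sqn (z + w) + sqn (z - w) = 2 * (sqn z + sqn w).
Proof. case: z => a b; case: w => c d; rewrite /sqn /=; ring. Qed.

(** The parallelogram law with one term dropped. As [sqn] is a squared modulus, the factor [2]
    stands in for the triangle inequality. *)
Lemma sqnD_le z w : sqn (z + w) <= 2 * (sqn z + sqn w).
Proof. by rewrite -sqn_parallelogram lerDl sqn_ge0. Qed.

Lemma sqn_eq0 z : sqn z = 0 -> z = 0.
Proof.
case: z => a b; rewrite /sqn /= => /eqP.
by rewrite paddr_eq0 ?sqr_ge0// !sqrf_eq0 => /andP[/eqP -> /eqP ->].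
Qed.

Lemma expiD (a b : R) : expi (a + b) = expi a * expi b.
Proof.
by apply: complex_ext => /=; rewrite ?cosD ?sinD; ring.
Qed.

Lemma expi0 : expi 0 = 1 :> R[i].
Proof. by rewrite /expi cos0 sin0. Qed.

Lemma expiNK (a : R) : expi a * expi (- a) = 1.
Proof. by rewrite -expiD subrr expi0. Qed.

Lemma sqn_expi (a : R) : sqn (expi a) = 1.
Proof. by rewrite /sqn /= cos2Dsin2. Qed.

Lemma expi2pi_int (k : int) : expi (2 * pi * k%:~R) = 1 :> R[i].
Proof.
have per (x : R) : expi (2 * pi * (x + 1)) = expi (2 * pi * x).
  rewrite mulrDr mulr1 expiD; have -> : 2 * pi = pi *+ 2 :> R by ring.
  by rewrite [X in _ * X](_ : _ = 1) ?mulr1// /expi cos2pi sin2pi.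
have := periodic_intr (f := fun x : R => expi (2 * pi * x)) per k 0.
by rewrite add0r mulr0 expi0.
Qed.

End SquareModulus.

(** * Measurability and the squared L^2 norm over one period *)

Section SquareNorm.
Variable R : realType.
Implicit Types f g : R -> R[i].

Definition measurable_complex f : Prop :=
  measurable_fun setT (fun x => complex.Re (f x)) /\
  measurable_fun setT (fun x => complex.Im (f x)).

Definition norm2 f : \bar R :=
  (\int[lebesgue_measure]_(x in `[0%R, 1%R]) (sqn (f x))%:E)%E.

Lemma measurable_complex_cst (c : R[i]) : measurable_complex (fun=> c).
Proof. by split; exact: measurable_cst. Qed.

Lemma measurable_complexD f g : measurable_complex f -> measurable_complex g ->
  measurable_complex (fun x => f x + g x).
Proof.
move=> [rf jf] [rg jg]; split.
  rewrite (_ : (fun x => _) =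
    (fun x => complex.Re (f x)) \+ (fun x => complex.Re (g x))).
    exact: measurable_funD.
  by apply/funext => x /=; case: (f x); case: (g x).
rewrite (_ : (fun x => _) =
    (fun x => complex.Im (f x)) \+ (fun x => complex.Im (g x))).
  exact: measurable_funD.
by apply/funext => x /=; case: (f x); case: (g x).
Qed.

Lemma measurable_complexM f g : measurable_complex f -> measurable_complex g ->
  measurable_complex (fun x => f x * g x).
Proof.
move=> [rf jf] [rg jg]; split.
  rewrite (_ : (fun x => _) = (fun x =>
      complex.Re (f x) * complex.Re (g x) -
      complex.Im (f x) * complex.Im (g x))).
    by apply: measurable_funB; exact: measurable_funM.
  by apply/funext => x /=; case: (f x); case: (g x).
rewrite (_ : (fun x => _) = (fun x =>
    complex.Re (f x) * complex.Im (g x) + complex.Im (f x) * complex.Re (g x))).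
  by apply: measurable_funD; exact: measurable_funM.
by apply/funext => x /=; case: (f x); case: (g x).
Qed.

Lemma measurable_complexB f g : measurable_complex f -> measurable_complex g ->
  measurable_complex (fun x => f x - g x).
Proof.
move=> mf mg.
rewrite (_ : (fun x => _) = (fun x => f x + (- 1) * g x)); last first.
  by apply/funext => x; rewrite mulN1r.
by apply: measurable_complexD => //; apply: measurable_complexM.
Qed.

Lemma measurable_complex_sum (I : Type) (r : seq I) (F : I -> R -> R[i]) :
  (forall i, measurable_complex (F i)) ->
  measurable_complex (fun x => \sum_(i <- r) F i x).
Proof.
move=> mF; elim: r => [|i r IH].
  rewrite (_ : (fun x => _) = fun=> 0); first exact: measurable_complex_cst.
  by apply/funext => x; rewrite big_nil.
rewrite (_ : (fun x => _) = fun x => F i x + \sum_(j <- r) F j x).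
  exact: measurable_complexD.
by apply/funext => x; rewrite big_cons.
Qed.

Lemma measurable_complex_expi (u : R -> R) : measurable_fun setT u ->
  measurable_complex (fun x => expi (u x)).
Proof.
move=> mu; split => /=.
  apply: (measurableT_comp _ mu).
  by apply: continuous_measurable_fun; exact: continuous_cos.
apply: (measurableT_comp _ mu).
by apply: continuous_measurable_fun; exact: continuous_sin.
Qed.

Lemma measurable_complex_translation f (t : R) : measurable_complex f ->
  measurable_complex (fun x => f (x + t)).
Proof.
have mt : measurable_fun setT (fun x : R => x + t) by exact: measurable_funD.
move=> [rf jf].
by split; [exact: (measurableT_comp rf mt)|exact: (measurableT_comp jf mt)].
Qed.

Lemma measurable_sqn f : measurable_complex f ->
  measurable_fun setT (fun x => (sqn (f x))%:E).
Proof.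
move=> [rf jf]; apply/measurable_EFinP.
by apply: measurable_funD; exact: measurable_funX.
Qed.

Lemma norm2_ge0 f : (0 <= norm2 f)%E.
Proof. by apply: integral_ge0 => x _; rewrite lee_fin sqn_ge0. Qed.

Lemma norm2_cst (c : R[i]) : norm2 (fun=> c) = (sqn c)%:E.
Proof.
rewrite /norm2 (integral_cst _ _ (sqn c)%:E) //.
have /= -> := @lebesgue_measure_itv R `[0%R, 1%R].
by rewrite lte_fin ltr01 -EFinB subr0 mule1.
Qed.

Lemma norm2_le f g (k : R) : 0 <= k ->
  measurable_complex f -> measurable_complex g ->
  (forall x, sqn (f x) <= k * sqn (g x)) -> (norm2 f <= k%:E * norm2 g)%E.
Proof.
move=> k0 mf mg fg; rewrite /norm2 -ge0_integralZl_EFin//; last 2 first.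
- by move=> x _; rewrite lee_fin sqn_ge0.
- by apply: measurable_funTS; exact: measurable_sqn.
apply: ge0_le_integral => //.
- by move=> x _; rewrite lee_fin sqn_ge0.
- by apply: measurable_funTS; exact: measurable_sqn.
- by apply: measurable_funeM; apply: measurable_funTS; exact: measurable_sqn.
- by move=> x _; rewrite -EFinM lee_fin.
Qed.

Lemma norm2_eq f g : (forall x, sqn (f x) = sqn (g x)) -> norm2 f = norm2 g.
Proof. by move=> fg; apply: eq_integral => x _; rewrite fg. Qed.

Lemma norm2D_le f g : measurable_complex f -> measurable_complex g ->
  (norm2 (fun x => f x + g x)%R <= 2%:E * (norm2 f + norm2 g))%E.
Proof.
move=> mf mg; rewrite /norm2 -ge0_integralD//; last 4 first.
- by move=> x _; rewrite lee_fin sqn_ge0.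
- by apply: measurable_funTS; exact: measurable_sqn.
- by move=> x _; rewrite lee_fin sqn_ge0.
- by apply: measurable_funTS; exact: measurable_sqn.
have mD : measurable_fun (`[0%R, 1%R]%classic : set R)
    (fun x => (sqn (f x))%:E + (sqn (g x))%:E)%E.
  by apply: emeasurable_funD; apply: measurable_funTS; exact: measurable_sqn.
rewrite -ge0_integralZl_EFin//; last first.
  by move=> x _; rewrite -EFinD lee_fin addr_ge0 ?sqn_ge0.
apply: ge0_le_integral => //.
- by move=> x _; rewrite lee_fin sqn_ge0.
- by apply: measurable_funTS; apply: measurable_sqn; exact: measurable_complexD.
- exact: measurable_funeM.
- by move=> x _; rewrite -EFinD -EFinM lee_fin sqnD_le.
Qed.

Lemma norm2B_le f g : measurable_complex f -> measurable_complex g ->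
  (norm2 (fun x => f x - g x)%R <= 2%:E * (norm2 f + norm2 g))%E.
Proof.
move=> mf mg; rewrite -[norm2 g](norm2_eq (f := fun x => 0 - g x)).
  rewrite (_ : (fun x => _) = fun x => f x + (0 - g x)); last first.
    by apply/funext => x; rewrite sub0r.
  by apply: norm2D_le => //; apply: measurable_complexB.
by move=> x; rewrite sub0r sqnN.
Qed.

Lemma norm2_translation f (t : R) : measurable_complex f ->
  (forall x, f (x + 1) = f x) -> norm2 (fun x => f (x + t)) = norm2 f.
Proof.
move=> mf per.
apply: (ge0_integral_periodic t (f := fun x => (sqn (f x))%:E)).
- exact: measurable_sqn.
- by move=> x; rewrite lee_fin sqn_ge0.
- by move=> x; rewrite per.
Qed.

(** Turns distance [0] in L^2 into equality almost everywhere on the period. *)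
Lemma norm2_eq0_negligible f : measurable_complex f -> norm2 f = 0%E ->
  lebesgue_measure.-negligible [set x : R | `[0%R, 1%R]%classic x /\ f x <> 0].
Proof.
move=> mf f0.
have : (\int[lebesgue_measure]_(x in `[0%R, 1%R]) `|(sqn (f x))%:E| = 0)%E.
  rewrite -f0; apply: eq_integral => x _.
  by rewrite gee0_abs// lee_fin sqn_ge0.
move=> /ae_eq_integral_abs -/(_ _ _)/= ae; apply: negligibleS (ae _ _).
- by move=> x /= [x01 fx0] /(_ x01) [] /sqn_eq0.
- exact: measurable_itv.
- by apply: measurable_funTS; exact: measurable_sqn.
Qed.

End SquareNorm.

(** * Functions represented by two-sided trigonometric series *)

Section FourierSeries.
Variable R : realType.
Implicit Types (f g : R -> R[i]) (c d : int -> R[i]).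

Lemma cvge0_le (u v : nat -> \bar R) (k : R) :
  (forall n, 0 <= u n <= k%:E * v n)%E -> v @ \oo --> 0%E -> u @ \oo --> 0%E.
Proof.
move=> uv v0.
apply: (@squeeze_cvge _ _ _ _ (fun=> 0%E) _ (fun n => k%:E * v n)%E).
- exact: nearW.
- exact: cvg_cst.
- by rewrite -[X in _ --> X](mule0 k%:E); exact: cvgeZl.
Qed.

Lemma cvge0D (u v : nat -> \bar R) : u @ \oo --> 0%E -> v @ \oo --> 0%E ->
  (fun n => u n + v n)%E @ \oo --> 0%E.
Proof. by move=> u0 v0; rewrite -[X in _ --> X](adde0 0%E); exact: cvgeD. Qed.

(** Same shape as [hat_partial], so that the convergence in [IsHat] is convergence of these sums by
    mere unfolding. *)
Definition trig_sum c (M : nat) (x : R) : R[i] :=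
  \sum_(j < (M + M).+1)
     expi (- (2 * pi * (j%:Z - M%:Z)%:~R * x)) * c (j%:Z - M%:Z).

(** The decay fields serve the index shifts: moving the window [[-M, M]] by one leaves two boundary
    terms, which must vanish in the limit. *)
Record represents c f : Prop := Represents {
  represents_measurable : measurable_complex f;
  represents_periodic : forall x, f (x + 1) = f x;
  represents_decayl : (fun M : nat => (sqn (c (- M%:Z)))%:E) @ \oo --> 0%E;
  represents_decayr : (fun M : nat => (sqn (c M%:Z))%:E) @ \oo --> 0%E;
  represents_cvg :
    (fun M => norm2 (fun x => f x - trig_sum c M x)) @ \oo --> 0%E
}.

Lemma measurable_character (a : R) :
  measurable_complex (fun x : R => expi (a * x)).
Proof. by apply: measurable_complex_expi; exact: measurable_funM. Qed.

Lemma measurable_trig_sum c M : measurable_complex (trig_sum c M).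
Proof.
apply: measurable_complex_sum => j; apply: measurable_complexM.
  under eq_fun do rewrite -mulNr.
  exact: measurable_character.
exact: measurable_complex_cst.
Qed.

Lemma trig_sumE c M x : trig_sum c M x = \sum_(0 <= j < (M + M).+1)
  expi (- (2 * pi * (j%:Z - M%:Z)%:~R * x)) * c (j%:Z - M%:Z).
Proof. by rewrite big_mkord. Qed.

Lemma trig_sumS c M x : trig_sum c M.+1 x = trig_sum c M x +
  (expi (2 * pi * M.+1%:R * x) * c (- M.+1%:Z) +
   expi (- (2 * pi * M.+1%:R * x)) * c M.+1%:Z).
Proof.
rewrite !trig_sumE addSn addnS big_nat_recl// big_nat_recr//= [LHS]addrCA.
congr (_ + (_ + _)).
- by apply: eq_bigr => j _; congr (expi (- (2 * pi * _%:~R * x)) * c _); lia.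
- rewrite sub0r; congr (expi _ * _); rewrite rmorphN /=; ring.
- have -> : (M + M).+2%:Z - M.+1%:Z = M.+1%:Z by lia.
  by [].
Qed.

(** The character moves the index window from [[-M, M]] to [[-M-1, M-1]]: compared with the sum over
    [[-M, M]], the term at [-M-1] is extra and the term at [M] is missing. *)
Lemma trig_sum_shift c M x :
  expi (2 * pi * x) * trig_sum c M x = trig_sum (fun m => c (m + 1)) M x +
  (expi (2 * pi * M.+1%:R * x) * c (- M%:Z) -
   expi (- (2 * pi * M%:R * x)) * c (M%:Z + 1)).
Proof.
pose F (i : int) := expi (- (2 * pi * i%:~R * x)) * c (i + 1).
have -> : expi (2 * pi * x) * trig_sum c M x =
    \sum_(0 <= j < (M + M).+1) F (j%:Z - M.+1%:Z).
  rewrite trig_sumE mulr_sumr; apply: eq_bigr => j _.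
  rewrite mulrA -expiD /F; congr (expi _ * c _); last by lia.
  have -> : j%:Z - M.+1%:Z = j%:Z - M%:Z - 1 by lia.
  rewrite rmorphB /=; ring.
have FM : F ((M + M).+1%:Z - M.+1%:Z) =
    expi (- (2 * pi * M%:R * x)) * c (M%:Z + 1).
  rewrite /F; have -> : (M + M).+1%:Z - M.+1%:Z = M%:Z by lia.
  by [].
have F0 : F (0%:Z - M.+1%:Z) = expi (2 * pi * M.+1%:R * x) * c (- M%:Z).
  rewrite /F; congr (expi _ * c _); last by lia.
  rewrite sub0r rmorphN /=; ring.
(* Once the term at [M] is moved across, both sides are the sum of [F] over [[-M-1, M]], peeled at
   the top and at the bottom. *)
rewrite -FM -F0 addrA; apply/eqP; rewrite eq_sym subr_eq; apply/eqP.
rewrite -(big_nat_recr (M + M).+1 0)// big_nat_recl// addrC trig_sumE.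
congr (_ + _).
by apply: eq_bigr => j _; congr F; lia.
Qed.

Lemma trig_sum_translation c M x (t : R) :
  trig_sum (fun m => expi (2 * pi * (m%:~R * t)) * c m) M x =
  trig_sum c M (x - t).
Proof.
apply: eq_bigr => j _; rewrite mulrA -expiD; congr (expi _ * _); ring.
Qed.

Lemma trig_sumD c d M x :
  trig_sum (fun m => c m + d m) M x = trig_sum c M x + trig_sum d M x.
Proof. by rewrite -big_split; apply: eq_bigr => j _; rewrite mulrDr. Qed.

Lemma trig_sumZ (a : R[i]) c M x :
  trig_sum (fun m => a * c m) M x = a * trig_sum c M x.
Proof. by rewrite mulr_sumr; apply: eq_bigr => j _; rewrite mulrCA. Qed.

Lemma measurable_sub_trig_sum c f : measurable_complex f ->
  forall M, measurable_complex (fun x => f x - trig_sum c M x).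
Proof.
by move=> mf M; apply: measurable_complexB => //; exact: measurable_trig_sum.
Qed.

Lemma representsD c d f g : represents c f -> represents d g ->
  represents (fun m => c m + d m) (fun x => f x + g x).
Proof.
move=> [mf pf lf rf cf] [mg pg lg rg cg]; split.
- exact: measurable_complexD.
- by move=> x; rewrite pf pg.
- apply: (@cvge0_le _ _ 2 _ (cvge0D lf lg)) => n.
  by rewrite -EFinD -EFinM !lee_fin sqn_ge0 sqnD_le.
- apply: (@cvge0_le _ _ 2 _ (cvge0D rf rg)) => n.
  by rewrite -EFinD -EFinM !lee_fin sqn_ge0 sqnD_le.
- apply: (@cvge0_le _ _ 2 _ (cvge0D cf cg)) => M; rewrite norm2_ge0 /=.
  rewrite (_ : (fun x => _) =
      fun x => (f x - trig_sum c M x) + (g x - trig_sum d M x)).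
    by apply: norm2D_le; exact: measurable_sub_trig_sum.
  by apply/funext => x; rewrite trig_sumD; ring.
Qed.

Lemma representsZ (a : R[i]) c f : represents c f ->
  represents (fun m => a * c m) (fun x => a * f x).
Proof.
move=> [mf pf lf rf cf]; split.
- by apply: measurable_complexM => //; exact: measurable_complex_cst.
- by move=> x; rewrite pf.
- apply: (@cvge0_le _ _ (sqn a) _ lf) => n.
  by rewrite -EFinM !lee_fin sqn_ge0 sqnM /=.
- apply: (@cvge0_le _ _ (sqn a) _ rf) => n.
  by rewrite -EFinM !lee_fin sqn_ge0 sqnM /=.
- apply: (@cvge0_le _ _ (sqn a) _ cf) => M; rewrite norm2_ge0 /=.
  rewrite (_ : (fun x => _) = fun x => a * (f x - trig_sum c M x)); last first.
    by apply/funext => x; rewrite trig_sumZ mulrBr.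
  apply: norm2_le; rewrite ?sqn_ge0//.
  + apply: measurable_complexM; first exact: measurable_complex_cst.
    exact: measurable_sub_trig_sum.
  + exact: measurable_sub_trig_sum.
  + by move=> x; rewrite sqnM.
Qed.

(** The twist has modulus one, so decay is kept. The new remainder is the translated old one, and
    its norm is unchanged because it is 1-periodic. *)
Lemma represents_translation c f (t : R) : represents c f ->
  represents (fun m => expi (2 * pi * (m%:~R * t)) * c m) (fun x => f (x - t)).
Proof.
move=> [mf pf lf rf cf]; split.
- exact: measurable_complex_translation.
- by move=> x; rewrite -addrA (addrC 1) addrA pf.
- by under eq_fun do rewrite sqnM sqn_expi mul1r.
- by under eq_fun do rewrite sqnM sqn_expi mul1r.
- apply: cvg_trans cf; apply: near_eq_cvg; apply: nearW => M.
  rewrite [RHS](norm2_eq (g := fun x => f (x - t) - trig_sum c M (x - t)));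
    last first.
    by move=> x; rewrite trig_sum_translation.
  rewrite (norm2_translation (f := fun x => f x - trig_sum c M x)) //.
    exact: measurable_sub_trig_sum.
  move=> x; rewrite pf; congr (_ - _); apply: eq_bigr => j _; congr (_ * _).
  rewrite mulrDr mulr1 opprD expiD.
  rewrite [X in _ * expi X](_ : _ = 2 * pi * (- (j%:Z - M%:Z))%:~R).
    by rewrite expi2pi_int mulr1.
  by rewrite rmorphN mulrN.
Qed.

Lemma norm2_boundary_le (a b : R[i]) (r s : R) :
  (norm2 (fun x : R => expi (r * x) * a - expi (s * x) * b)%R <=
   2%:E * ((sqn a)%:E + (sqn b)%:E))%E.
Proof.
rewrite -EFinD -EFinM.
have norm2_1 : norm2 (fun=> 1 : R[i]) = 1%E by rewrite norm2_cst sqn1.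
rewrite -[X in (_ <= X)%E]mule1 -[X in (_ * X)%E]norm2_1.
apply: norm2_le.
- by rewrite mulr_ge0// addr_ge0 ?sqn_ge0.
- by apply: measurable_complexB; apply: measurable_complexM;
    try exact: measurable_complex_cst; exact: measurable_character.
- exact: measurable_complex_cst.
- move=> x; rewrite sqn1 mulr1.
  by rewrite (le_trans (sqnD_le _ _))// sqnN !sqnM !sqn_expi !mul1r.
Qed.

(** Absorbs the two boundary terms of an index shift into a remainder [h] that tends to [0]. *)
Lemma norm2_boundary_cvg0 (h : nat -> R -> R[i]) (a b : nat -> R[i])
    (r s : nat -> R) : (forall M, measurable_complex (h M)) ->
  (fun M => norm2 (h M)) @ \oo --> 0%E ->
  (fun M => (sqn (a M))%:E) @ \oo --> 0%E ->
  (fun M => (sqn (b M))%:E) @ \oo --> 0%E ->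
  (fun M => norm2 (fun x : R => h M x +
    (expi (r M * x) * a M - expi (s M * x) * b M))%R) @ \oo --> 0%E.
Proof.
move=> mh h0 a0 b0.
(* The factor-[2] inequality is used twice: [2 * (u + 2 * w) <= 4 * (u + w)]. *)
apply: (@cvge0_le _ _ 4 _ (cvge0D h0 (cvge0D a0 b0))) => M.
rewrite norm2_ge0 /=.
apply: (le_trans (norm2D_le _ _)) => //.
  by apply: measurable_complexB; apply: measurable_complexM;
    try exact: measurable_complex_cst; exact: measurable_character.
have := norm2_ge0 (h M).
have := norm2_boundary_le (a M) (b M) (r M) (s M).
move: (norm2 (h M)) => u.
move: (norm2 _) => v vle u0.
apply: (@le_trans _ _
  (2%:E * (u + 2%:E * ((sqn (a M))%:E + (sqn (b M))%:E)))%E).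
  by rewrite lee_pmul2l// leeD2l.
case: u u0 => [u| |] //; last first.
  move=> _; rewrite -EFinD [X in (_ <= _ * X)%E]addye//.
  by rewrite [X in (_ <= X)%E]gt0_muley ?leey// lte_fin.
rewrite -!EFinD -!EFinM !lee_fin => u0; lra.
Qed.

Lemma expi2piS (x : R) : expi (2 * pi * (x + 1)) = expi (2 * pi * x).
Proof.
by rewrite mulrDr expiD [X in _ * X](expi2pi_int R 1) mulr1.
Qed.

(** The new remainder is the old one times a unimodular character, plus the boundary terms of
    [trig_sum_shift]. *)
Lemma represents_shift c f : represents c f ->
  represents (fun m => c (m + 1)) (fun x => expi (2 * pi * x) * f x).
Proof.
move=> [mf pf lf rf cf].
have rS : (fun M : nat => (sqn (c (M%:Z + 1)))%:E) @ \oo --> 0%E.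
  have := rf; rewrite -cvg_shiftS; apply: cvg_trans.
  by apply: near_eq_cvg; apply: nearW => M; rewrite /= -addn1 PoszD.
split=> //.
- by apply: measurable_complexM => //; exact: measurable_character.
- by move=> x; rewrite pf expi2piS.
- rewrite -cvg_shiftS; apply: cvg_trans lf.
  apply: near_eq_cvg; apply: nearW => M; congr (sqn (c _))%:E; lia.
- pose h M x := expi (2 * pi * x) * (f x - trig_sum c M x).
  have mh M : measurable_complex (h M).
    apply: measurable_complexM; first exact: measurable_character.
    exact: measurable_sub_trig_sum.
  have h0 : (fun M => norm2 (h M)) @ \oo --> 0%E.
    apply: cvg_trans cf; apply: near_eq_cvg; apply: nearW => M.
    by apply: norm2_eq => x; rewrite sqnM sqn_expi mul1r.
  apply: cvg_trans (norm2_boundary_cvg0 (fun M => 2 * pi * M.+1%:R)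
    (fun M => - (2 * pi * M%:R)) mh h0 lf rS).
  apply: near_eq_cvg; apply: nearW => M.
  apply: norm2_eq => x; congr sqn.
  by rewrite /h mulrBr trig_sum_shift mulNr; ring.
Qed.

(** The opposite shift comes from [trig_sum_shift] applied to the sequence [c (m - 1)]. *)
Lemma represents_unshift c f : represents c f ->
  represents (fun m => c (m - 1)) (fun x => expi (- (2 * pi * x)) * f x).
Proof.
move=> [mf pf lf rf cf].
have lS : (fun M : nat => (sqn (c (- M%:Z - 1)))%:E) @ \oo --> 0%E.
  have := lf; rewrite -cvg_shiftS; apply: cvg_trans.
  apply: near_eq_cvg; apply: nearW => M /=; congr (sqn (c _))%:E; lia.
split=> //.
- apply: measurable_complexM => //; under eq_fun do rewrite -mulNr.
  exact: measurable_character.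
- move=> x; rewrite pf -mulrN opprD.
  by rewrite -[in LHS]expi2piS subrK mulrN.
- rewrite -cvg_shiftS; apply: cvg_trans rf.
  apply: near_eq_cvg; apply: nearW => M; congr (sqn (c _))%:E; lia.
- apply: cvg_trans (norm2_boundary_cvg0 (fun M => - (2 * pi * M%:R))
    (fun M => 2 * pi * M.+1%:R) (measurable_sub_trig_sum c mf) cf rf lS).
  apply: near_eq_cvg; apply: nearW => M.
  apply: norm2_eq => x.
  have e1 : expi (2 * pi * x) * expi (- (2 * pi * x)) = 1 by exact: expiNK.
  have := trig_sum_shift (fun m => c (m - 1)) M x.
  have -> : trig_sum (fun m => c (m + 1 - 1)) M x = trig_sum c M x.
    by apply: eq_bigr => j _; rewrite addrK.
  rewrite addrK => tE.
  (* Multiplying the remainder by the unimodular [expi (2 * pi * x)] cancels the character in front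
     of [f] and leaves [sqn] unchanged. *)
  rewrite -[RHS]mul1r -[X in _ = X * _](sqn_expi (2 * pi * x)) -sqnM; congr sqn.
  rewrite mulrBr tE [expi _ * (_ * f x)]mulrA. rewrite e1 mul1r mulNr; ring.
Qed.

(** The common partial sums cancel in the difference of the remainders, so a constant sequence tends
    to [0]. *)
Lemma represents_unique c f g : represents c f -> represents c g ->
  norm2 (fun x => f x - g x) = 0%E.
Proof.
move=> [mf pf lf rf cf] [mg pg lg rg cg].
have h : (fun M : nat => norm2 (fun x => f x - g x)) @ \oo --> 0%E.
  apply: (@cvge0_le _ _ 2 _ (cvge0D cf cg)) => M; rewrite norm2_ge0 /=.
  rewrite (_ : (fun x => f x - g x) =
      fun x => (f x - trig_sum c M x) - (g x - trig_sum c M x)).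
    by apply: norm2B_le; exact: measurable_sub_trig_sum.
  by apply/funext => x; ring.
exact: (cvg_unique (@ereal_hausdorff R) (cvg_cst _) h).
Qed.

Lemma expi_quarter (y : R) : expi (y + pi / 2) = iC R * expi y.
Proof. by apply: complex_ext => /=; rewrite ?cosDpihalf ?sinDpihalf; ring. Qed.

Lemma expiN_quarter (y : R) : expi (- (y + pi / 2)) = - iC R * expi (- y).
Proof.
apply: complex_ext => /=; rewrite !(cosN, sinN) ?cosDpihalf ?sinDpihalf; ring.
Qed.

(* The decay of the coefficients is automatic: the difference [D] of two
   consecutive partial sums tends to [0] in L^2, and each of its two terms is a
   combination of [D x] and the quarter-period translate [D (x + q)]. *)
Lemma representsI c f : measurable_complex f -> (forall x, f (x + 1) = f x) ->
  (fun M => norm2 (fun x => f x - trig_sum c M x)) @ \oo --> 0%E ->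
  represents c f.
Proof.
move=> mf pf cf.
pose D M x := trig_sum c M.+1 x - trig_sum c M x.
have mD M : measurable_complex (D M).
  by apply: measurable_complexB; exact: measurable_trig_sum.
have D0 : (fun M => norm2 (D M)) @ \oo --> 0%E.
  have cfS : (fun M => norm2 (fun x => f x - trig_sum c M.+1 x)) @ \oo --> 0%E.
    by have := cf; rewrite -cvg_shiftS.
  apply: (@cvge0_le _ _ 2 _ (cvge0D cf cfS)) => M; rewrite norm2_ge0 /=.
  rewrite (_ : D M =
      fun x => (f x - trig_sum c M x) - (f x - trig_sum c M.+1 x)).
    by apply: norm2B_le; exact: measurable_sub_trig_sum.
  by apply/funext => x; rewrite /D; ring.
have DE M x : D M x = expi (2 * pi * M.+1%:R * x) * c (- M.+1%:Z) +
    expi (- (2 * pi * M.+1%:R * x)) * c M.+1%:Z.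
  by rewrite /D trig_sumS addrC addKr.
have pD M x : D M (x + 1) = D M x.
  have e1 : expi (2 * pi * M.+1%:R) = 1 := expi2pi_int R M.+1.
  rewrite !DE (mulrDr (2 * pi * M.+1%:R)) mulr1 opprD !expiD e1.
  rewrite [expi (- (2 * pi * M.+1%:R))](_ : _ = 1) ?mulr1//.
  by rewrite -[RHS](expi2pi_int R (- M.+1%:Z)) rmorphN mulrN.
(* A quarter of the period of the character of frequency [M.+1]: the phase grows by [pi / 2], which
   multiplies the two terms of [D] by [iC R] and [- iC R]. *)
pose q M : R := 4^-1 / M.+1%:R.
have qE M x : 2 * pi * M.+1%:R * (x + q M) = 2 * pi * M.+1%:R * x + pi / 2.
  have : M.+1%:R != 0 :> R by rewrite pnatr_eq0.
  by rewrite /q; move: M.+1%:R pi => k p k0; field.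
have DqE M x : D M (x + q M) =
    iC R * (expi (2 * pi * M.+1%:R * x) * c (- M.+1%:Z) -
            expi (- (2 * pi * M.+1%:R * x)) * c M.+1%:Z).
  by rewrite DE qE expi_quarter expiN_quarter; ring.
have Dq M : norm2 (fun x => D M (x + q M)) = norm2 (D M).
  exact: norm2_translation.
(* When a combination with unimodular [e] isolates one term, [4 * sqn (d M) <= 2 * (norm2 (D M) +
   norm2 (D M))], hence the constant [1]. *)
have decay (d : nat -> R[i]) (s : nat -> R) (e : R[i]) : sqn e = 1 ->
    (forall M x, 2 * (expi (s M * x) * d M) = D M x + e * D M (x + q M)) ->
    forall M, (0 <= (sqn (d M))%:E <= 1%:E * norm2 (D M))%E.
  move=> e1 dE M; rewrite lee_fin sqn_ge0 /= mul1e.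
  have : (norm2 (fun x => 2 * (expi (s M * x) * d M))%R <=
          2%:E * (norm2 (D M) + norm2 (D M)))%E.
    under eq_fun do rewrite dE.
    have eDq : norm2 (fun x => e * D M (x + q M)) = norm2 (D M).
      by rewrite -(Dq M); apply: norm2_eq => x; rewrite sqnM e1 mul1r.
    rewrite -[X in (_ <= _ * (_ + X))%E]eDq.
    apply: norm2D_le => //.
    apply: measurable_complexM; first exact: measurable_complex_cst.
    exact: measurable_complex_translation.
  rewrite (norm2_eq (g := fun=> 2 * d M)); last first.
    by move=> x; rewrite !sqnM sqn_expi mul1r.
  rewrite norm2_cst sqnM (_ : sqn 2 = 4) //; last first.
    have := @sqn_parallelogram R 1 1; rewrite subrr sqn1.
    rewrite [sqn 0]/sqn /= expr0n !addr0 => ->; ring.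
  have := norm2_ge0 (D M); case: (norm2 (D M)) => [u| |] //; last first.
    by move=> *; rewrite leey.
  rewrite -EFinD -EFinM !lee_fin => u0; lra.
split=> //.
- rewrite -cvg_shiftS; apply: (cvge0_le _ D0).
  (* [- iC R] cancels the factor [iC R] of [DqE], so the sum doubles the first term of [D]. *)
  apply: (decay (fun M => c (- M.+1%:Z)) (fun M => 2 * pi * M.+1%:R) (- iC R)).
    by rewrite sqnN /sqn /= expr0n expr1n add0r.
  move=> M x; rewrite DqE DE [X in _ = _ + X]mulrA.
  rewrite (_ : - iC R * iC R = 1); last by apply: complex_ext => /=; ring.
  ring.
- rewrite -cvg_shiftS; apply: (cvge0_le _ D0).
  (* [iC R] turns that factor into [-1], so the sum doubles the second term. *)
  apply: (decay (fun M => c M.+1%:Z) (fun M => - (2 * pi * M.+1%:R)) (iC R)).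
    by rewrite /sqn /= expr0n expr1n add0r.
  move=> M x; rewrite DqE DE [X in _ = _ + X]mulrA.
  rewrite (_ : iC R * iC R = -1); last by apply: complex_ext => /=; ring.
  rewrite mulNr; ring.
Qed.

End FourierSeries.

(** * Fourier coefficients of square-integrable functions *)

Section FourierCoefficient.
Variable R : realType.
Implicit Types f g : R -> R[i].

Definition square_integrable f : Prop :=
  measurable_complex f /\ (norm2 f < +oo)%E.

Lemma square_integrableD f g : square_integrable f -> square_integrable g ->
  square_integrable (fun x => f x + g x).
Proof.
move=> [mf nf] [mg ng]; split; first exact: measurable_complexD.
apply: (le_lt_trans (norm2D_le mf mg)).
by rewrite lte_mul_pinfty// ?lee_fin// lte_add_pinfty.
Qed.

Lemma square_integrable_expi f (u : R -> R) : measurable_fun setT u ->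
  square_integrable f -> square_integrable (fun x => expi (u x) * f x).
Proof.
move=> mu [mf nf]; split.
  by apply: measurable_complexM => //; exact: measurable_complex_expi.
by rewrite (norm2_eq (g := f))// => x; rewrite sqnM sqn_expi mul1r.
Qed.

Lemma square_integrableZ (a : R[i]) f : square_integrable f ->
  square_integrable (fun x => a * f x).
Proof.
move=> [mf nf]; split.
  by apply: measurable_complexM => //; exact: measurable_complex_cst.
have naf : (norm2 (fun x => a * f x)%R <= (sqn a)%:E * norm2 f)%E.
  apply: norm2_le; rewrite ?sqn_ge0//; last by move=> x; rewrite sqnM.
  by apply: measurable_complexM => //; exact: measurable_complex_cst.
apply: (le_lt_trans naf).
by rewrite lte_mul_pinfty// ?lee_fin ?sqn_ge0.
Qed.

(** The period has finite measure, so [1 + sqn (f x)] is integrable; it dominates both parts of [f]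
    because [(|u| - 1)^2 >= 0]. *)
Lemma square_integrable_integrable f : square_integrable f ->
  lebesgue_measure.-integrable `[0%R, 1%R]
    (EFin \o (fun x => complex.Re (f x))) /\
  lebesgue_measure.-integrable `[0%R, 1%R]
    (EFin \o (fun x => complex.Im (f x))).
Proof.
move=> [mf nf].
have i1 : lebesgue_measure.-integrable (`[0%R, 1%R]%classic : set R)
    (fun x : R => (1 + sqn (f x))%:E).
  have i0 : lebesgue_measure.-integrable (`[0%R, 1%R]%classic : set R)
      (EFin \o fun=> 1 : R).
    apply/integrableP; split; first exact: measurable_cst.
    under eq_integral do rewrite /= normr1.
    rewrite integral_cst//.
    have /= -> := @lebesgue_measure_itv R `[0%R, 1%R].
    by rewrite lte_fin ltr01 -EFinB subr0 mule1 ltry.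
  rewrite (_ : (fun x => _) =
    ((EFin \o fun=> 1%R : R) \+ (fun x : R => (sqn (f x))%:E))%E) //.
  apply: integrableD => //.
  apply/integrableP; split.
    by apply: measurable_funTS; exact: measurable_sqn.
  under eq_integral do rewrite gee0_abs ?lee_fin ?sqn_ge0//.
  exact: nf.
have abs_le (u v : R) : `|u| <= `|1 + (u ^+ 2 + v ^+ 2)|.
  rewrite [leRHS]ger0_norm; last by rewrite !addr_ge0// sqr_ge0.
  have := sqr_ge0 (`|u| - 1); have := sqr_ge0 v.
  rewrite -(real_normK (num_real u)).
  have := normr_ge0 u; nra.
split; apply: (le_integrable _ _ _ i1) => //=.
- by apply/measurable_EFinP; apply: measurable_funTS; case: mf.
- by move=> x _; rewrite lee_fin abs_le.
- by apply/measurable_EFinP; apply: measurable_funTS; case: mf.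
- by move=> x _; rewrite lee_fin /sqn (addrC (_ ^+ 2)) abs_le.
Qed.

Lemma cintD f g : square_integrable f -> square_integrable g ->
  cint (fun x => f x + g x) = cint f + cint g.
Proof.
move=> /square_integrable_integrable[rf jf].
move=> /square_integrable_integrable[rg jg].
apply: complex_ext => /=.
  rewrite -RintegralD//; apply: eq_Rintegral => x _.
  by case: (f x); case: (g x).
rewrite -RintegralD//; apply: eq_Rintegral => x _.
by case: (f x); case: (g x).
Qed.

Lemma cintZ (a : R[i]) f : square_integrable f ->
  cint (fun x => a * f x) = a * cint f.
Proof.
move=> /square_integrable_integrable[rf jf].
have iZ (k : R) (h : R -> R) :
    lebesgue_measure.-integrable `[0%R, 1%R] (EFin \o h) ->
    lebesgue_measure.-integrable `[0%R, 1%R] (EFin \o (fun x => k * h x)).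
  by move=> ih; apply: (integrableZl _ k ih).
case: a => a b; rewrite /cint; apply: complex_ext => /=.
  rewrite -!RintegralZl// -RintegralB//; [|exact: iZ..].
  by apply: eq_Rintegral => x _; case: (f x).
rewrite -!RintegralZl// -RintegralD//; [|exact: iZ..].
by apply: eq_Rintegral => x _; case: (f x).
Qed.

(** [fcoef Psi m n s] unfolds to [fourier_coef (Psi m s) n]. *)
Definition fourier_coef f (n : int) : R[i] :=
  cint (fun x => expi (- (2 * pi * n%:~R * x)) * f x).

Lemma square_integrable_character f (n : int) : square_integrable f ->
  square_integrable (fun x => expi (- (2 * pi * n%:~R * x)) * f x).
Proof.
by apply: square_integrable_expi; apply: measurableT_comp.
Qed.

Lemma fourier_coefD f g n : square_integrable f -> square_integrable g ->
  fourier_coef (fun x => f x + g x) n = fourier_coef f n + fourier_coef g n.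
Proof.
move=> sf sg; rewrite /fourier_coef -cintD;
  try exact: square_integrable_character.
by congr cint; apply/funext => x; rewrite mulrDr.
Qed.

Lemma fourier_coefZ (a : R[i]) f n : square_integrable f ->
  fourier_coef (fun x => a * f x) n = a * fourier_coef f n.
Proof.
move=> sf; rewrite /fourier_coef -cintZ; try exact: square_integrable_character.
by congr cint; apply/funext => x; rewrite mulrCA.
Qed.

Lemma fourier_coef_shift f n :
  fourier_coef (fun x => expi (2 * pi * x) * f x) n = fourier_coef f (n - 1).
Proof.
congr cint; apply/funext => x; rewrite mulrA -expiD; congr (expi _ * _).
rewrite rmorphB /=; ring.
Qed.

Lemma fourier_coef_unshift f n :
  fourier_coef (fun x => expi (- (2 * pi * x)) * f x) n =
  fourier_coef f (n + 1).
Proof.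
congr cint; apply/funext => x; rewrite mulrA -expiD; congr (expi _ * _).
rewrite rmorphD /=; ring.
Qed.

End FourierCoefficient.

(** * Coordinate formulas for [S], [Q] and the transpose of [W] *)

Section Operators.
Variable R : realType.

(** [S] moves the [+] component right and the [-] component left, so site [n] reads [+] from [n - 1]
    and [-] from [n + 1]. *)
Lemma SappE (l : R) psi n : Sapp l psi n =1 fun s =>
  if s then rC l * psi (n - 1) true - rC (lamp l) * psi n false
  else rC l * psi (n + 1) false + rC (lamp l) * psi n true.
Proof.
have e0 : n + 0%:Z - 1 = n - 1 by lia.
have e1 : n + 1%:Z - 1 = n by lia.
have e2 : n + 2%:Z - 1 = n + 1 by lia.
have f1 : (n == n - 1) = false by apply/negbTE; lia.
have f2 : (n == n + 1) = false by apply/negbTE; lia.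
have f3 : (n == n - 1 - 1) = false by apply/negbTE; lia.
have f4 : (n == n + 1 + 1) = false by apply/negbTE; lia.
case; rewrite /Sapp !big_ord_recl big_ord0 !big_bool /= e0 e1 e2 /Sdelta /delta;
  rewrite ?subrK ?addrK f1 f2 ?f3 ?f4 eqxx /=; ring.
Qed.

Lemma Qapp_delta (l Phi theta : R) m t n s :
  Qapp l Phi theta (delta R m t) n s =
  if n == m then Qent l Phi theta n s t else 0.
Proof.
rewrite /Qapp big_bool /delta.
case: (n == m) => /=; last by rewrite !mulr0 addr0.
by case: t => /=; rewrite mulr1 mulr0 ?addr0 ?add0r.
Qed.

(** This is [W^T = Q^T S^T]: the brackets are the coordinates of [S^T psi], with reversed hops, and
    [Q] enters with exchanged indices and no conjugation. *)
Lemma WTopE (l1 l2 Phi theta : R) psi m t :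
  WTop l1 l2 Phi theta psi m t =
  Qent l2 Phi theta m true t *
    (rC l1 * psi (m + 1) true + rC (lamp l1) * psi m false) +
  Qent l2 Phi theta m false t *
    (rC l1 * psi (m - 1) false - rC (lamp l1) * psi m true).
Proof.
have e0 : m + 0%:Z - 1 = m - 1 by lia.
have e1 : m + 1%:Z - 1 = m by lia.
have e2 : m + 2%:Z - 1 = m + 1 by lia.
have f1 : (m - 1 == m) = false by apply/negbTE; lia.
have f2 : (m + 1 == m) = false by apply/negbTE; lia.
have f3 : (m - 1 - 1 == m) = false by apply/negbTE; lia.
have f4 : (m + 1 + 1 == m) = false by apply/negbTE; lia.
rewrite /WTop /transp3 !big_ord_recl big_ord0 !big_bool /= e0 e1 e2 /Wop !SappE.
rewrite !Qapp_delta ?subrK ?addrK f1 f2 ?f3 ?f4 eqxx /=; ring.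
Qed.
End Operators.

(** * Aubry duality: conjugation by [X] and passage to the Fourier side *)

Section Duality.
Variable R : realType.

Definition signed_i (s : bool) : R[i] := if s then iC R else - iC R.

(* [X S_l^T Psi] in terms of [U = X Psi]; it commutes with taking Fourier
   coefficients in [x], so [F] ranges over values of [U] and over its
   coefficients. *)
Definition hop (l : R) (F : int -> bool -> R[i]) (m : int) (s : bool) : R[i] :=
  rC (l / 2) * (F (m + 1) s + F (m - 1) s) +
  (signed_i s * rC (l / 2)) * (F (m + 1) (~~ s) + (-1) * F (m - 1) (~~ s)) +
  (signed_i s * rC (lamp l)) * F m s.

(* [hop l] on the Fourier side, where [m + 1] and [m - 1] become multiplication
   by characters; by [Qapp_symbol] this is the matrix [Q_l]. *)
Definition symbol (l eta : R) (z : bool -> R[i]) (s : bool) : R[i] :=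
  rC (l / 2) * (expi (2 * pi * eta) * z s + expi (- (2 * pi * eta)) * z s) +
  (signed_i s * rC (l / 2)) * (expi (2 * pi * eta) * z (~~ s) +
                         (-1) * (expi (- (2 * pi * eta)) * z (~~ s))) +
  (signed_i s * rC (lamp l)) * z s.

(** Euler's formulas: the half-sum of the characters is the cosine, and [signed_i s] turns their
    half-difference into minus the sine for [+] and the sine for [-]. *)
Lemma Qapp_symbol (l Phi theta : R) psi n s :
  Qapp l Phi theta psi n s = symbol l (n%:~R * Phi + theta) (psi n) s.
Proof.
rewrite /Qapp big_bool /symbol /Qent; set a := 2 * pi * _.
rewrite /expi cosN sinN; move: (cos a) (sin a) (lamp l) => c d p.
by case: s => /=; case: (psi n true) => u v; case: (psi n false) => u' v';
  apply: complex_ext => /=; field.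
Qed.

Lemma square_integrable_hop (l : R) (F : int -> bool -> R -> R[i]) m s :
  (forall m s, square_integrable (F m s)) ->
  square_integrable (fun x => hop l (fun m s => F m s x) m s).
Proof.
move=> sF; apply: square_integrableD; last exact: square_integrableZ.
by apply: square_integrableD; apply: square_integrableZ;
  apply: square_integrableD => //; exact: square_integrableZ.
Qed.

Lemma fourier_coef_hop (l : R) (F : int -> bool -> R -> R[i]) m s n :
  (forall m s, square_integrable (F m s)) ->
  fourier_coef (fun x => hop l (fun m s => F m s x) m s) n =
  hop l (fun m s => fourier_coef (F m s) n) m s.
Proof.
move=> sF; have sZ a m' s' : square_integrable (fun x => a * F m' s' x).
  exact: square_integrableZ.
rewrite /hop !fourier_coefD ?fourier_coefZ ?fourier_coefD ?fourier_coefZ //.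
- exact: square_integrableD.
- exact: square_integrableD.
- by apply: square_integrableZ; exact: square_integrableD.
- by apply: square_integrableZ; exact: square_integrableD.
- apply: square_integrableD; apply: square_integrableZ;
    exact: square_integrableD.
Qed.

Lemma represents_hop (l : R) (C : int -> bool -> R[i])
    (g : bool -> R -> R[i]) s :
  (forall s, represents (C ^~ s) (g s)) ->
  represents (fun m => hop l C m s) (fun eta => symbol l eta (g ^~ eta) s).
Proof.
move=> Cg; have r1 t := represents_shift (Cg t).
have r2 t := represents_unshift (Cg t).
apply: representsD (representsZ _ (Cg s)).
apply: representsD; first exact: representsZ _ (representsD (r1 s) (r2 s)).
exact: representsZ _ (representsD (r1 (~~ s)) (representsZ _ (r2 (~~ s)))).
Qed.

(** Conjugation by [X] diagonalizes the rotation in [Q_l1^T] into two opposite characters and makes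
    the diagonal [lamp l1] part real and antidiagonal. The phase is split: the [m Phi] factor is
    constant in [x] and will twist coefficients, the other will shift their index. Writing [- Phi]
    matches [represents_translation]. *)
Lemma Xop_WTop (l1 l2 Phi : R) (Psi : field R) m s x :
  Xop (dint (WTop l2 l1 Phi) Psi) m s x =
  let V := hop l2 (fun m s => Xop Psi m s x) m in
  if s then
    rC l1 * (expi (2 * pi * (m%:~R * Phi)) * (expi (2 * pi * x) * V true)) +
    (- rC (lamp l1)) * V false
  else
    rC l1 *
      (expi (2 * pi * (m%:~R * - Phi)) * (expi (- (2 * pi * x)) * V false)) +
    rC (lamp l1) * V true.
Proof.
rewrite /Xop /dint !big_bool /Xent; move: (Num.sqrt 2)^-1 => r.
rewrite !WTopE /hop !big_bool /fiber /Qent /=.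
have -> (z : R[i]) : expi (2 * pi * (m%:~R * Phi)) * (expi (2 * pi * x) * z) =
    expi (2 * pi * (m%:~R * Phi + x)) * z.
  by rewrite mulrA -expiD -mulrDr.
have -> (z : R[i]) :
    expi (2 * pi * (m%:~R * - Phi)) * (expi (- (2 * pi * x)) * z) =
    expi (- (2 * pi * (m%:~R * Phi + x))) * z.
  by rewrite mulrA -expiD; congr (expi _ * _); ring.
move: (2 * pi * _) => a; rewrite /expi cosN sinN.
move: (cos a) (sin a) (lamp l1) (lamp l2) => c d p1 p2.
move: (Psi (m + 1) true x) (Psi (m + 1) false x) => [a1 a2] [b1 b2].
move: (Psi (m - 1) true x) (Psi (m - 1) false x) => [c1 c2] [d1 d2].
move: (Psi m true x) (Psi m false x) => [e1 e2] [f1 f2].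
by case: s => /=; apply: complex_ext => /=; field.
Qed.

Lemma square_integrable_Xop (Psi : field R) m s : InH Psi ->
  square_integrable (Xop Psi m s).
Proof.
move=> [_ [mPsi sPsi]].
have sI n t : square_integrable (Psi n t).
  split; first exact: mPsi.
  (* A single term is bounded by the finite sum of all squared norms. *)
  apply: le_lt_trans sPsi; apply: esum_ge; exists [set (n, t)].
    by split => //; exact: finite_set1.
  by rewrite fsbig_set1.
rewrite (_ : Xop Psi m s =
    fun x => Xent R s true * Psi m true x + Xent R s false * Psi m false x).
  by apply: square_integrableD; exact: square_integrableZ.
by apply/funext => x; rewrite /Xop big_bool.
Qed.

(** The hops of [S_l1] appear here: as in [SappE], [+] reads from [n - 1] and [-] from [n + 1]. *)
Lemma fourier_coef_Xop_WTop (l1 l2 Phi : R) (Psi : field R) m s n :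
  InH Psi ->
  let V m s x := hop l2 (fun m s => Xop Psi m s x) m s in
  fourier_coef (Xop (dint (WTop l2 l1 Phi) Psi) m s) n =
  if s then
    rC l1 *
      (expi (2 * pi * (m%:~R * Phi)) * fourier_coef (V m true) (n - 1)) +
    (- rC (lamp l1)) * fourier_coef (V m false) n
  else
    rC l1 *
      (expi (2 * pi * (m%:~R * - Phi)) * fourier_coef (V m false) (n + 1)) +
    rC (lamp l1) * fourier_coef (V m true) n.
Proof.
move=> HPsi V.
have sV t : square_integrable (V m t).
  by apply: square_integrable_hop => m' s'; exact: square_integrable_Xop.
case: s.
  rewrite (_ : Xop _ m true = fun x =>
      rC l1 * (expi (2 * pi * (m%:~R * Phi)) *
               (expi (2 * pi * x) * V m true x)) +
      (- rC (lamp l1)) * V m false x); last first.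
    by apply/funext => x; rewrite Xop_WTop.
  have s1 : square_integrable (fun x => expi (2 * pi * x) * V m true x).
    by apply: square_integrable_expi => //; exact: measurable_funM.
  have s2 := square_integrableZ (expi (2 * pi * (m%:~R * Phi))) s1.
  rewrite fourier_coefD; try exact: square_integrableZ.
  by rewrite !fourier_coefZ// fourier_coef_shift.
rewrite (_ : Xop _ m false = fun x =>
    rC l1 * (expi (2 * pi * (m%:~R * - Phi)) *
             (expi (- (2 * pi * x)) * V m false x)) +
    rC (lamp l1) * V m true x); last first.
  by apply/funext => x; rewrite Xop_WTop.
have s1 : square_integrable (fun x => expi (- (2 * pi * x)) * V m false x).
  by apply: square_integrable_expi => //; apply: measurableT_comp.
have s2 := square_integrableZ (expi (2 * pi * (m%:~R * - Phi))) s1.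
rewrite fourier_coefD; try exact: square_integrableZ.
by rewrite !fourier_coefZ// fourier_coef_unshift.
Qed.

End Duality.

Unset Implicit Arguments.

(* W A_Phi X Psi = A_Phi X W^T Psi  in H_plus, for every Psi in H_plus:
   G1 = (X Psi)^hat, G2 = (X W^T_{l2,l1,Phi} Psi)^hat, and the two sides
   agree for a.e. theta in T (identified with [0,1]), in every coordinate. *)
Theorem theorem5 (R : realType) (l1 l2 Phi : R) :
  0 <= l1 <= 1 -> 0 <= l2 <= 1 ->
  (forall q : rat, Phi != ratr q) ->
  forall Psi G1 G2 : field R,
    InH Psi ->
    IsHat (Xop Psi) G1 ->
    IsHat (Xop (dint (fun theta => WTop l2 l1 Phi theta) Psi)) G2 ->
    lebesgue_measure.-negligible
      [set theta : R | `[0%R, 1%R]%classic theta /\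
         exists n s,
           dint (fun theta => Wop l1 l2 Phi theta) (Ashift Phi G1) n s theta
           <> Ashift Phi G2 n s theta].
Proof.
move=> _ _ _ Psi G1 G2 HPsi [[pG1 [mG1 _]] cG1] [[pG2 [mG2 _]] cG2].
pose U := Xop Psi.
pose Y := Xop (dint (WTop l2 l1 Phi) Psi).
have sU m s : square_integrable (U m s) by exact: square_integrable_Xop.
(* Duality exchanges the variables: for fixed [n] and [s], the site [m] of [Psi] is the frequency in
   the series of [G1 n s]. *)
have rG1 n s : represents (fun m => fourier_coef (U m s) n) (G1 n s).
  by apply: representsI => //; exact: cG1.
have rG2 n s : represents (fun m => fourier_coef (Y m s) n) (G2 n s).
  by apply: representsI => //; exact: cG2.
(* [V] is [X S_l2^T Psi]; its coefficients will represent [H], which is [Q_l2] acting on [G1] before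
   the Aubry shift. *)
pose V m s x := hop l2 (fun m s => U m s x) m s.
have sV m s : square_integrable (V m s) by exact: square_integrable_hop.
pose H n s eta := symbol l2 eta (fun t => G1 n t eta) s.
have rH n s : represents (fun m => fourier_coef (V m s) n) (H n s).
  rewrite (_ : (fun m => _) =
      fun m => hop l2 (fun m s => fourier_coef (U m s) n) m s).
    exact: (represents_hop l2 (C := fun m s => fourier_coef (U m s) n)
      (g := fun t => G1 n t)).
  by apply/funext => m; rewrite fourier_coef_hop.
(* The left side of the identity in the variable [eta = theta + n Phi]. The sites [n - 1] and
   [n + 1] carry one [Phi] less or more, hence the translations by [Phi] and [- Phi]. *)
pose T n (s : bool) eta :=
  if s then rC l1 * H (n - 1) true (eta - Phi) +
            (- rC (lamp l1)) * H n false eta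
  else rC l1 * H (n + 1) false (eta - - Phi) + rC (lamp l1) * H n true eta.
have rT n s : represents (fun m => fourier_coef (Y m s) n) (T n s).
  under eq_fun do rewrite fourier_coef_Xop_WTop//.
  case: s; apply: representsD; apply: representsZ; try exact: rH.
    exact: (represents_translation Phi (rH (n - 1) true)).
  exact: (represents_translation (- Phi) (rH (n + 1) false)).
have TE n s theta :
    dint (fun theta => Wop l1 l2 Phi theta) (Ashift Phi G1) n s theta =
    T n s (theta + n%:~R * Phi).
  rewrite /dint /Wop SappE !Qapp_symbol /T /H /fiber /Ashift.
  have eN : theta + n%:~R * Phi = n%:~R * Phi + theta by rewrite addrC.
  have e1 : theta + n%:~R * Phi - Phi = (n - 1)%:~R * Phi + theta.
    by rewrite rmorphB /=; ring.
  have e2 : theta + n%:~R * Phi - - Phi = (n + 1)%:~R * Phi + theta.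
    by rewrite rmorphD /=; ring.
  by rewrite e1 e2 eN; case: s; rewrite ?mulNr.
pose Z n s := [set theta : R | `[0%R, 1%R]%classic theta /\
  T n s (theta + n%:~R * Phi) - G2 n s (theta + n%:~R * Phi) <> 0].
have negZ n s : lebesgue_measure.-negligible (Z n s).
  have [mT pT _ _ _] := rT n s.
  have mD : measurable_complex (fun eta => T n s eta - G2 n s eta).
    exact: measurable_complexB.
  apply: (norm2_eq0_negligible (f := fun theta =>
    T n s (theta + n%:~R * Phi) - G2 n s (theta + n%:~R * Phi))).
    exact: (measurable_complex_translation _ mD).
  (* Periodicity removes the translation by [n Phi], leaving two functions with the same
     coefficients. *)
  rewrite (norm2_translation _ mD).
    exact: represents_unique (rT n s) (rG2 n s).
  by move=> x; rewrite pT pG2.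
(* The pairs [(n, s)] are countable: [pickle] numbers them, and numbers that encode no pair get the
   empty set. *)
pose E k := if unpickle k is Some (n, s) then Z n s else set0.
have negE : lebesgue_measure.-negligible (\bigcup_k E k).
  apply: negligible_bigcup => k; rewrite /E.
  by case: (unpickle k) => [[n s]|]; [exact: negZ|exact: negligible_set0].
apply: negligibleS negE => theta [t01 [n [s ne]]]; exists (pickle (n, s)) => //.
rewrite /E pickleK; split => // /eqP; rewrite subr_eq0 -TE => /eqP e.
by apply: ne; rewrite e /Ashift addrC.
Qed.
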